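(* Let $\mathfrak{A}=\bigoplus_{i,j\in\mathbb{N}}\mathfrak{A}_{i,-j}$ be a Peirce algebra and let $d\in\mathbb{N}$. If $\mathfrak{A}_d=\mathfrak{A}_{d,-d}$ is strongly unital and the ideal $\mathsf{Z}_d=\mathsf{Z}_d(\mathfrak{A})\subseteq \mathfrak{A}_{0,0}$ is unital as a ring, then there is an equivalence of categories between $\mathfrak{A}_d$-modules and $\mathsf{Z}_d$-modules.
   Context: All algebras are associative but not necessarily commutative or unital; ideals are regarded as rings; modules are left modules, and modules over a unital ring are assumed unital. $\mathbb{N}=\mathbb{Z}_{\ge 0}$. A Peirce algebra is a (not necessarily unital) algebra $\mathfrak{A}$ over a commutative ring $R$, with product denoted $\star$, together with an $R$-module bigrading $\mathfrak{A}=\bigoplus_{i,j\in\mathbb{N}}\mathfrak{A}_{i,-j}$ such that: (1) $\mathfrak{A}_{i,-j}\star\mathfrak{A}_{k,-\ell}\subseteq\delta_{j,k}\mathfrak{A}_{i,-\ell}$ (so the product is zero if $j\ne k$); (2) $\mathsf{A}:=\mathfrak{A}_{0,0}$ is a unital algebra; (3) the product makes $\mathfrak{A}_{i,0}$ a unital right $\mathsf{A}$-module and $\mathfrak{A}_{0,-j}$ a unital left $\mathsf{A}$-module; (4) the product induces an isomorphism $\mathfrak{A}_{d,0}\otimes_{\mathsf{A}}\mathfrak{A}_{0,-d}\cong\mathfrak{A}_{d,-d}$ for every $d$. $\mathfrak{A}_d:=\mathfrak{A}_{d,-d}$ is a subalgebra. It is called strongly unital if there is an element $1_d\in\mathfrak{A}_d$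 (a strong identity) with $x\star 1_d=x$ for all $x\in\mathfrak{A}_{0,-d}$ and $1_d\star y=y$ for all $y\in\mathfrak{A}_{d,0}$. $\mathcal{Z}_d:=\mathfrak{A}_{0,-d}\otimes_{\mathfrak{A}_d}\mathfrak{A}_{d,0}$ (the quotient of the tensor product over $R$ by the relations $x\star a\otimes y=x\otimes a\star y$, $a\in\mathfrak{A}_d$), and $\mathsf{Z}_d$ is the image of the map $\mathcal{Z}_d\to\mathsf{A}$, $x\otimes y\mapsto x\star y$. It is a two-sided ideal of $\mathsf{A}$. *)

(* Defs.v *)
From HB Require Import structures.
From mathcomp Require Import all_boot all_algebra ring_quotient generic_quotient.
From mathcomp Require Import boolp.
From mathcomp Require Import freeg.

Set Implicit Arguments.
Unset Strict Implicit.
Unset Printing Implicit Defensive.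

Import GRing.Theory.
Import Quotient.Exports.

Local Open Scope ring_scope.
Local Open Scope quotient_scope.

Record category := Category {
  obj :> Type;
  hom : obj -> obj -> Type;
  idm : forall x, hom x x;
  comp : forall x y z, hom y z -> hom x y -> hom x z;
  comp1m : forall x y (f : hom x y), comp (idm y) f = f;
  compm1 : forall x y (f : hom x y), comp f (idm x) = f;
  compmA : forall x y z t (h : hom z t) (g : hom y z) (f : hom x y),
    comp h (comp g f) = comp (comp h g) f
}.
Arguments idm {c} x.
Arguments comp {c x y z}.

Record functor (C D : category) := Functor {
  fobj :> C -> D;
  fmor : forall x y, hom x y -> hom (fobj x) (fobj y);
  fmor1 : forall x, fmor (idm x) = idm (fobj x);
  fmorM : forall x y z (g : hom y z) (f : hom x y),
    fmor (comp g f) = comp (fmor g) (fmor f)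
}.
Arguments fmor {C D} _ {x y} _.

Definition functor_id (C : category) : functor C C :=
  @Functor C C id (fun _ _ => id) (fun _ => erefl) (fun _ _ _ _ _ => erefl).

Section FunctorComp.
Variables (C D E : category) (G : functor D E) (F : functor C D).

Lemma functor_comp1 x : fmor G (fmor F (idm x)) = idm (G (F x)).
Proof. by rewrite !fmor1. Qed.

Lemma functor_compM x y z (g : hom y z) (f : hom x y) :
  fmor G (fmor F (comp g f)) = comp (fmor G (fmor F g)) (fmor G (fmor F f)).
Proof. by rewrite !fmorM. Qed.

Definition functor_comp : functor C E :=
  @Functor C E (fun x => G (F x)) (fun _ _ f => fmor G (fmor F f))
    functor_comp1 functor_compM.

End FunctorComp.

Record nat_iso (C D : category) (F G : functor C D) := NatIso {
  niso : forall x, hom (F x) (G x);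
  niso_inv : forall x, hom (G x) (F x);
  nisoK : forall x, comp (niso_inv x) (niso x) = idm (F x);
  niso_invK : forall x, comp (niso x) (niso_inv x) = idm (G x);
  niso_nat : forall x y (f : hom x y),
    comp (niso y) (fmor F f) = comp (fmor G f) (niso x)
}.

Definition equivalent (C D : category) : Prop :=
  exists (F : functor C D) (G : functor D C),
    inhabited (nat_iso (functor_comp G F) (functor_id C)) /\
    inhabited (nat_iso (functor_comp F G) (functor_id D)).

Section ModuleCategory.
Variable S : pzRingType.

Definition lin_id (M : lmodType S) : {linear M -> M} := idfun.
Definition lin_comp (M N P : lmodType S)
  (g : {linear N -> P}) (f : {linear M -> N}) : {linear M -> P} := g \o f.

Lemma lin_eq (M N : lmodType S) (f g : {linear M -> N}) : f =1 g -> f = g.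
Proof.
case: f g => [f [[f1] [f2]]] [g [[g1] [g2]]] /= /funext efg; subst g.
by rewrite (Prop_irrelevance f1 g1) (Prop_irrelevance f2 g2).
Qed.

Lemma lin_comp1m (M N : lmodType S) (f : {linear M -> N}) : lin_comp (lin_id N) f = f.
Proof. exact: lin_eq. Qed.
Lemma lin_compm1 (M N : lmodType S) (f : {linear M -> N}) : lin_comp f (lin_id M) = f.
Proof. exact: lin_eq. Qed.
Lemma lin_compA (M N P Q : lmodType S) (h : {linear P -> Q}) (g : {linear N -> P})
    (f : {linear M -> N}) :
  lin_comp h (lin_comp g f) = lin_comp (lin_comp h g) f.
Proof. exact: lin_eq. Qed.

Definition ModCat : category :=
  @Category (lmodType S) (fun M N : lmodType S => {linear M -> N}) lin_id lin_comp
    lin_comp1m lin_compm1 lin_compA.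

End ModuleCategory.

Record rng := Rng {
  rng_sort :> zmodType;
  rmul : rng_sort -> rng_sort -> rng_sort;
  rmulA : associative rmul;
  rmulDl : left_distributive rmul +%R;
  rmulDr : right_distributive rmul +%R
}.

Definition unital (S : rng) : Prop :=
  exists e : S, left_id e (@rmul S) /\ right_id e (@rmul S).

(* A unital rng as a unital ring.  The zero ring is allowed, hence pzRingType
   below.  The identity extracted by [cid] is the only one there is. *)
Definition unital_ring (S : rng) (h : unital S) : Type := S.

Section UnitalRing.
Variables (S : rng) (h : unital S).

HB.instance Definition _ := GRing.Zmodule.on (unital_ring h).
HB.instance Definition _ := GRing.Zmodule_isPzRing.Build (unital_ring h)
  (@rmulA S) (proj1 (svalP (cid h))) (proj2 (svalP (cid h)))
  (@rmulDl S) (@rmulDr S).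

End UnitalRing.

(* [tensor ract lact] is the quotient of the tensor product of the R-modules X
   and Y over R by the relations x.a (x) y = x (x) a.y for a in S: the free
   abelian group on X * Y modulo the subgroup generated by biadditivity and by
   R- and S-balancedness.  [S] need not have an identity. *)
Section Tensor.
Variables (R : comPzRingType) (X Y : lmodType R) (S : Type).
Variables (ract : X -> S -> X) (lact : S -> Y -> Y).

Local Notation F := {freeg (X * Y)%type / int}.
Local Notation "<[ x , y ]>" := (<< (x, y) >> : F).

Inductive tensor_null : F -> Prop :=
| TensorDl x x' y : tensor_null (<[x + x', y]> - <[x, y]> - <[x', y]>)
| TensorDr x y y' : tensor_null (<[x, y + y']> - <[x, y]> - <[x, y']>)
| TensorZ r x y : tensor_null (<[r *: x, y]> - <[x, r *: y]>)
| TensorBal x a y : tensor_null (<[ract x a, y]> - <[x, lact a y]>)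
| Tensor0 : tensor_null 0
| TensorB g h : tensor_null g -> tensor_null h -> tensor_null (g - h).

Definition tensor_ker : {pred F} := fun g => `[< tensor_null g >].

Lemma tensor_ker_closed : zmod_closed tensor_ker.
Proof.
split=> [|g h]; first exact/asboolP/Tensor0.
by move=> /asboolP ng /asboolP nh; apply/asboolP/TensorB.
Qed.

HB.instance Definition _ := GRing.isZmodClosed.Build F tensor_ker
  tensor_ker_closed.

Definition tensor : Type := Quotient.quot tensor_ker.
HB.instance Definition _ := GRing.Zmodule.on tensor.
HB.instance Definition _ := Quotient.on tensor.

Definition tens (x : X) (y : Y) : tensor := \pi_tensor <[x, y]>.

Section Lift.
Variables (W : zmodType) (f : X -> Y -> W).

Record balanced : Prop := Balanced {
  balDl : forall x x' y, f (x + x') y = f x y + f x' y;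
  balDr : forall x y y', f x (y + y') = f x y + f x y';
  balZ : forall r x y, f (r *: x) y = f x (r *: y);
  balA : forall x a y, f (ract x a) y = f x (lact a y)
}.

(* The Z-linear extension of [f] to the free group. *)
Definition free_lift (g : F) : W := fglift (fun p => f p.1 p.2 : zmodule W) g.

Lemma free_liftU x y : free_lift <[x, y]> = f x y.
Proof. by rewrite /free_lift liftU scale1r. Qed.

Lemma free_liftB : {morph free_lift : g h / g - h}.
Proof. exact: (@lift_is_additive _ _ (zmodule W)). Qed.

Lemma free_lift0 : free_lift 0 = 0.
Proof. by rewrite -[X in free_lift X](subrr 0) free_liftB subrr. Qed.

Lemma free_lift_null : balanced -> forall g, tensor_null g -> free_lift g = 0.
Proof.
move=> bf g; elim=> {g} [x x' y|x y y'|r x y|x a y||g h _ g0 _ h0].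
- by rewrite !free_liftB !free_liftU (balDl bf) addrAC addrK subrr.
- by rewrite !free_liftB !free_liftU (balDr bf) addrAC addrK subrr.
- by rewrite free_liftB !free_liftU (balZ bf) subrr.
- by rewrite free_liftB !free_liftU (balA bf) subrr.
- exact: free_lift0.
- by rewrite free_liftB g0 h0 subrr.
Qed.

(* The homomorphism x (x) y |-> f x y, for a balanced [f]. *)
Definition tensor_lift (bf : balanced) (t : tensor) : W := free_lift (repr t).

Variable bf : balanced.

Lemma tensor_lift_pi g : tensor_lift bf (\pi_tensor g) = free_lift g.
Proof.
apply/eqP; rewrite -subr_eq0 -free_liftB; apply/eqP/(free_lift_null bf)/asboolP.
change (repr (\pi_tensor g) - g \in tensor_ker).
by rewrite Quotient.idealrBE reprK.
Qed.

Lemma tensor_liftE x y : tensor_lift bf (tens x y) = f x y.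
Proof. by rewrite tensor_lift_pi free_liftU. Qed.

Lemma tensor_liftB : {morph tensor_lift bf : s t / s - t}.
Proof.
by move=> s t; rewrite -[s]reprK -[t]reprK -raddfB !tensor_lift_pi free_liftB.
Qed.

End Lift.

Lemma tensor_ind (P : tensor -> Prop) :
  P 0 -> (forall s t, P s -> P t -> P (s - t)) ->
  (forall x y, P (tens x y)) -> forall t, P t.
Proof.
move=> P0 PB PU t; rewrite -[t]reprK -[repr t]freeg_sumE raddf_sum.
apply: (big_ind P) => // [s s' Ps Ps'|[x y] _].
  by rewrite -[s']opprK -[- s']sub0r; apply: (PB) => //; apply: (PB).
rewrite -[coeff _ _]intz -freeg_mulz raddfMz.
have PN s : P s -> P (- s) by move=> Ps; rewrite -sub0r; apply: (PB).
have PM n : P (tens x y *+ n).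
  elim: n => // n IH; rewrite mulrSr -[X in _ + X]opprK.
  by apply: (PB) => //; apply: (PN).
by case: (coeff _ _) => n; [exact: PM | rewrite NegzE mulrNz; apply: (PN); exact: PM].
Qed.

End Tensor.

Record algebra (R : comPzRingType) := Algebra {
  alg_sort :> lmodType R;
  amul : alg_sort -> alg_sort -> alg_sort;
  amulA : associative amul;
  amulDl : left_distributive amul +%R;
  amulDr : right_distributive amul +%R;
  amulZl : forall r x y, amul (r *: x) y = r *: amul x y;
  amulZr : forall r x y, amul x (r *: y) = r *: amul x y
}.

(* [grade A i j] is the component of bidegree (i, -j), for i, j natural.
   [gradeM] and [gradeM0] are the two cases of the Kronecker delta in
   A_(i,-j) * A_(k,-l) <= delta_(j,k) A_(i,-l). *)
Record bigraded_algebra (R : comPzRingType) := BigradedAlgebra {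
  bg_alg :> algebra R;
  grade : nat -> nat -> submodClosed bg_alg;
  grade_span : forall v : bg_alg, exists n (f : nat -> nat -> bg_alg),
    (forall i j, f i j \in grade i j) /\
    v = \sum_(i < n) \sum_(j < n) f i j;
  grade_free : forall n (f : nat -> nat -> bg_alg),
    (forall i j, f i j \in grade i j) ->
    \sum_(i < n) \sum_(j < n) f i j = 0 ->
    forall i j, (i < n)%N -> (j < n)%N -> f i j = 0;
  gradeM : forall i j l x y,
    x \in grade i j -> y \in grade j l -> amul x y \in grade i l;
  gradeM0 : forall i j k l x y, j != k ->
    x \in grade i j -> y \in grade k l -> amul x y = 0
}.

Section Component.
Variables (R : comPzRingType) (A : bigraded_algebra R).

Definition component (i j : nat) : Type := {x : A | x \in grade A i j}.

Section Instances.
Variables i j : nat.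
HB.instance Definition _ := SubChoice.on (component i j).
HB.instance Definition _ := [SubChoice_isSubLmodule of component i j by <:].
End Instances.

Definition cmul i j l (x : component i j) (y : component j l) : component i l :=
  exist _ (amul (val x) (val y)) (gradeM (valP x) (valP y)).

Lemma cmulA i j k l (x : component i j) (y : component j k)
  (z : component k l) : cmul x (cmul y z) = cmul (cmul x y) z.
Proof. by apply: val_inj; rewrite /= amulA. Qed.

Lemma cmulDl i j l (x x' : component i j) (y : component j l) :
  cmul (x + x') y = cmul x y + cmul x' y.
Proof. by apply: val_inj; rewrite /= amulDl. Qed.

Lemma cmulDr i j l (x : component i j) (y y' : component j l) :
  cmul x (y + y') = cmul x y + cmul x y'.
Proof. by apply: val_inj; rewrite /= amulDr. Qed.

Lemma cmulBl i j l (x x' : component i j) (y : component j l) :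
  cmul (x - x') y = cmul x y - cmul x' y.
Proof. by apply: (addIr (cmul x' y)); rewrite -cmulDl !subrK. Qed.

Lemma cmulBr i j l (x : component i j) (y y' : component j l) :
  cmul x (y - y') = cmul x y - cmul x y'.
Proof. by apply: (addIr (cmul x y')); rewrite -cmulDr !subrK. Qed.

Lemma cmul0r i j l (x : component j l) : cmul (0 : component i j) x = 0.
Proof. by rewrite -(subrr 0) cmulBl subrr. Qed.

Lemma cmulr0 i j l (x : component i j) : cmul x (0 : component j l) = 0.
Proof. by rewrite -(subrr 0) cmulBr subrr. Qed.

Lemma cmul_balanced i k l :
  balanced (@cmul i k k) (@cmul k k l) (@cmul i k l).
Proof.
split=> *; [exact: cmulDl | exact: cmulDr | | by rewrite cmulA].
by apply: val_inj; rewrite /= amulZl amulZr.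
Qed.

(* A_(i,-k) (x)_(A_(k,-k)) A_(k,-l) and the map x (x) y |-> x * y out of it. *)
Definition ctensor i k l := tensor (@cmul i k k) (@cmul k k l).
Definition cmul_map i k l : ctensor i k l -> component i l :=
  tensor_lift (cmul_balanced i k l).

Lemma cmul_mapB i k l : {morph @cmul_map i k l : s t / s - t}.
Proof. exact: tensor_liftB. Qed.

Lemma cmul_map0 i k l : @cmul_map i k l 0 = 0.
Proof. by rewrite -(subrr 0) cmul_mapB subrr. Qed.

Lemma cmul_mapE i k l x y : @cmul_map i k l (tens _ _ x y) = cmul x y.
Proof. exact: tensor_liftE. Qed.

(* A_d = A_(d,-d). *)
Definition diag_rng (d : nat) : rng :=
  @Rng (component d d) (@cmul d d d) (@cmulA d d d d)
    (@cmulDl d d d) (@cmulDr d d d).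

End Component.

(* The module axioms of A_(i,0) and A_(0,-j) over A_(0,0) other than those on
   the identity are instances of associativity and bilinearity.  In [peirce_iso]
   the map is additive, and R-linear and A_d-bilinear for the evident structure
   on the tensor product, so that it is an isomorphism as soon as it is
   bijective. *)
Record peirce_algebra (R : comPzRingType) := PeirceAlgebra {
  pa_bg :> bigraded_algebra R;
  pa_one : component pa_bg 0 0;
  pa_1mul : left_id pa_one (@cmul R pa_bg 0 0 0);
  pa_mul1 : right_id pa_one (@cmul R pa_bg 0 0 0);
  pa_act1 : forall i (x : component pa_bg i 0), cmul x pa_one = x;
  pa_1act : forall j (y : component pa_bg 0 j), cmul pa_one y = y;
  peirce_iso : forall d, bijective (@cmul_map R pa_bg d 0 d)
}.

Section Morita.
Variables (R : comPzRingType) (A : peirce_algebra R) (d : nat).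

Definition strong_identity (u : component A d d) : Prop :=
  (forall x : component A 0 d, cmul x u = x) /\
  (forall y : component A d 0, cmul u y = y).

Definition strongly_unital : Prop := exists u, strong_identity u.

Lemma strongly_unitalW : strongly_unital -> unital (diag_rng A d).
Proof.
move=> [u [xu uy]]; exists u.
have [g _ gK] := peirce_iso A d.
have H (z : component A d d) : cmul u z = z /\ cmul z u = z.
  rewrite -[z]gK; elim/tensor_ind: (g z) => [|s t [us su] [ut tu]|x y].
  - by rewrite cmul_map0 cmul0r cmulr0.
  - by rewrite cmul_mapB cmulBl cmulBr us su ut tu.
  - by rewrite cmul_mapE cmulA uy -cmulA xu.
by split=> z; case: (H z).
Qed.

(* The image of A_(0,-d) (x)_(A_d) A_(d,0) in A_(0,0), a two-sided ideal. *)
Definition Zideal : {pred component A 0 0} :=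
  fun a => `[< exists t : ctensor A 0 d 0, cmul_map t = a >].

Lemma Zideal_zmod_closed : zmod_closed Zideal.
Proof.
split=> [|a b /asboolP[s <-] /asboolP[t <-]]; apply/asboolP.
  by exists 0; rewrite cmul_map0.
by exists (s - t); rewrite cmul_mapB.
Qed.

HB.instance Definition _ :=
  GRing.isZmodClosed.Build (component A 0 0) Zideal Zideal_zmod_closed.

Lemma Zideal_cmul x y : @cmul R A 0 d 0 x y \in Zideal.
Proof. by apply/asboolP; exists (tens _ _ x y); rewrite cmul_mapE. Qed.

Lemma Zideal_mull (a b : component A 0 0) : b \in Zideal -> cmul a b \in Zideal.
Proof.
move=> /asboolP[t <-]; elim/tensor_ind: t => [|s t Zs Zt|x y].
- by rewrite cmul_map0 cmulr0 rpred0.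
- by rewrite cmul_mapB cmulBr rpredB.
- by rewrite cmul_mapE cmulA Zideal_cmul.
Qed.

Lemma Zideal_mulr (a b : component A 0 0) : a \in Zideal -> cmul a b \in Zideal.
Proof.
move=> /asboolP[t <-]; elim/tensor_ind: t => [|s t Zs Zt|x y].
- by rewrite cmul_map0 cmul0r rpred0.
- by rewrite cmul_mapB cmulBl rpredB.
- by rewrite cmul_mapE -cmulA Zideal_cmul.
Qed.

Definition Zsub : Type := {a : component A 0 0 | a \in Zideal}.
HB.instance Definition _ := SubChoice.on Zsub.
HB.instance Definition _ := [SubChoice_isSubZmodule of Zsub by <:].

Definition Zmul (a b : Zsub) : Zsub :=
  exist _ (cmul (val a) (val b)) (Zideal_mull (val a) (valP b)).

Lemma ZmulA : associative Zmul.
Proof. by move=> a b c; apply: val_inj; rewrite /= cmulA. Qed.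
Lemma ZmulDl : left_distributive Zmul +%R.
Proof. by move=> a b c; apply: val_inj; rewrite /= cmulDl. Qed.
Lemma ZmulDr : right_distributive Zmul +%R.
Proof. by move=> a b c; apply: val_inj; rewrite /= cmulDr. Qed.

Definition Z_rng : rng := Rng ZmulA ZmulDl ZmulDr.

End Morita.

(* Main.v *)
(* P = A_(0,-d) and Q = A_(d,0) form a Morita context between A_d and Z_d with
   pairings given by the product.  Q (x) P -> A_d is onto by the Peirce
   isomorphism, P (x) Q -> Z_d by the definition of Z_d.  The identity e of Z_d
   acts as the identity on P: writing 1_d = sum_i y_i x_i, every x in P equals
   x 1_d = sum_i (x y_i) x_i with x y_i in Z_d, where e is neutral; likewise for
   Q.  For a Morita context with pairing qp : Q (x) P -> S whose image contains
   1 = sum_i y_i x_i, the contraction Q (x) (P (x) M) -> M is inverted by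
   m |-> sum_i y_i (x) (x_i (x) m); applied to both pairings this makes P (x) _
   and Q (x) _ mutually inverse equivalences. *)

From HB Require Import structures.
From mathcomp Require Import all_boot all_algebra ring_quotient generic_quotient.
From mathcomp Require Import boolp freeg.
Require Import Defs.

Set Implicit Arguments.
Unset Strict Implicit.
Unset Printing Implicit Defensive.

Import GRing.Theory.
Import Quotient.Exports.

Local Open Scope ring_scope.
Local Open Scope quotient_scope.

(** * Pure tensors: balancedness, finite sums, and equality of maps *)

Section TensorTheory.
Variables (R : comPzRingType) (X Y : lmodType R) (S : Type).
Variables (ract : X -> S -> X) (lact : S -> Y -> Y).

Local Notation T := (tensor ract lact).
Local Notation "x '(x)' y" := (tens ract lact x y) (at level 40).

Lemma pi_tensor_null g : tensor_null ract lact g -> \pi_T g = 0.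
Proof.
move=> /asboolP; rewrite -[X in `[< tensor_null _ _ X >]](subr0 g) => g0.
have /eqP -> : \pi_T g == \pi_T 0 by rewrite -Quotient.idealrBE.
exact: raddf0.
Qed.

(** The generators of [tensor_null] are exactly the defects of the four balancedness identities, and
    they vanish in the quotient. *)
Lemma tens_balanced : balanced ract lact (tens ract lact).
Proof.
have piB g h : \pi_T (g - h) = \pi_T g - \pi_T h by exact: raddfB.
have piBB g h k : \pi_T (g - h - k) = 0 -> \pi_T g = \pi_T h + \pi_T k.
  by rewrite !piB -addrA -opprD => /subr0_eq.
split=> [x x' y|x y y'|r x y|x a y]; rewrite /tens.
- exact/piBB/pi_tensor_null/TensorDl.
- exact/piBB/pi_tensor_null/TensorDr.
- by apply: subr0_eq; rewrite -piB; exact/pi_tensor_null/TensorZ.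
- by apply: subr0_eq; rewrite -piB; exact/pi_tensor_null/TensorBal.
Qed.

Lemma tensBl x x' y : (x - x') (x) y = x (x) y - x' (x) y.
Proof. by apply: (addIr (x' (x) y)); rewrite -(balDl tens_balanced) !subrK. Qed.

Lemma tensBr x y y' : x (x) (y - y') = x (x) y - x (x) y'.
Proof. by apply: (addIr (x (x) y')); rewrite -(balDr tens_balanced) !subrK. Qed.

Lemma tens0l y : 0 (x) y = 0.
Proof. by rewrite -(subrr 0) tensBl subrr. Qed.

Lemma tensNl x y : (- x) (x) y = - (x (x) y).
Proof. by rewrite -sub0r tensBl tens0l sub0r. Qed.

Lemma tens_suml I (r : seq I) (F : I -> X) y :
  (\sum_(i <- r) F i) (x) y = \sum_(i <- r) F i (x) y.
Proof.
elim: r => [|i r IH]; first by rewrite !big_nil tens0l.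
by rewrite !big_cons (balDl tens_balanced) IH.
Qed.

(** Differences of sums of pure tensors are again such sums, since a sign can be absorbed in the
    left factor. *)
Lemma tensor_sum (t : T) :
  exists r : seq (X * Y), t = \sum_(p <- r) p.1 (x) p.2.
Proof.
elim/tensor_ind: t => [|_ _ [r ->] [r' ->]|x y].
- by exists [::]; rewrite big_nil.
- exists (r ++ [seq (- p.1, p.2) | p <- r']).
  rewrite big_cat big_map /= -sumrN; congr (_ + _).
  by apply: eq_bigr => p _; rewrite tensNl.
- by exists [:: (x, y)]; rewrite big_seq1.
Qed.

Lemma tensor_eq (W : zmodType) (f g : T -> W) :
  {morph f : s t / s - t} -> {morph g : s t / s - t} ->
  (forall x y, f (x (x) y) = g (x (x) y)) -> f =1 g.
Proof.
move=> fB gB fg; elim/tensor_ind => [|s t fs ft|//].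
  by rewrite -(subrr 0) fB gB !subrr.
by rewrite fB gB fs ft.
Qed.

End TensorTheory.

(** * Bimodules over unital rings and the functor of tensoring with one *)

Record bimodule (T S : pzRingType) := Bimodule {
  bim_sort :> zmodType;
  bim_lact : T -> bim_sort -> bim_sort;
  bim_ract : bim_sort -> S -> bim_sort;
  bim_lactDl : forall a b x, bim_lact (a + b) x = bim_lact a x + bim_lact b x;
  bim_lactDr : forall a x y, bim_lact a (x + y) = bim_lact a x + bim_lact a y;
  bim_lactA : forall a b x, bim_lact a (bim_lact b x) = bim_lact (a * b) x;
  bim_lact1 : forall x, bim_lact 1 x = x;
  bim_ractDl : forall a x y, bim_ract (x + y) a = bim_ract x a + bim_ract y a;
  bim_ractDr : forall a b x, bim_ract x (a + b) = bim_ract x a + bim_ract x b;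
  bim_ractA : forall a b x, bim_ract (bim_ract x a) b = bim_ract x (a * b);
  bim_ract1 : forall x, bim_ract x 1 = x;
  bim_lractA : forall a x b,
    bim_lact a (bim_ract x b) = bim_ract (bim_lact a x) b
}.

Section BimoduleTensor.
Variables (T S : pzRingType) (P : bimodule T S).

Lemma bim_lact_suml I (r : seq I) (F : I -> T) (x : P) :
  bim_lact (\sum_(i <- r) F i) x = \sum_(i <- r) bim_lact (F i) x.
Proof.
elim: r => [|i r IH]; last by rewrite !big_cons bim_lactDl IH.
by rewrite !big_nil; apply: (addIr (bim_lact 0 x)); rewrite -bim_lactDl !add0r.
Qed.

(* Over the integers the relation [TensorZ] follows from biadditivity, so this
   is the usual tensor product over S. *)
Definition bitensor (M : lmodType S) : Type :=
  @tensor int (zmodule P) (zmodule M) S (@bim_ract _ _ P) *:%R.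

Section Instances.
Variable M : lmodType S.

HB.instance Definition _ := GRing.Zmodule.on (bitensor M).

Definition bitens (x : P) (m : M) : bitensor M :=
  @tens int (zmodule P) (zmodule M) S (@bim_ract _ _ P) *:%R x m.

(** Integer multiples pass from one argument of a biadditive map to the other, which supplies the
    scalar relation of [balanced] over [int]. *)
Lemma biadditive_balanced (W : zmodType) (f : P -> M -> W) :
  (forall x x' m, f (x + x') m = f x m + f x' m) ->
  (forall x m m', f x (m + m') = f x m + f x m') ->
  (forall x a m, f (bim_ract x a) m = f x (a *: m)) ->
  @balanced int (zmodule P) (zmodule M) S (@bim_ract _ _ P) *:%R W f.
Proof.
move=> fDl fDr fA; split=> // r x m; rewrite !scalezrE.
have fBl y : GRing.zmod_morphism (f^~ y).
  by move=> u v; apply: (addIr (f v y)); rewrite -fDl !subrK.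
have fBr u : GRing.zmod_morphism (f u).
  by move=> y z; apply: (addIr (f u z)); rewrite -fDr !subrK.
pose fl : {additive P -> W} :=
  HB.pack (f^~ m) (GRing.isZmodMorphism.Build _ _ _ (fBl m)).
pose fr : {additive M -> W} :=
  HB.pack (f x) (GRing.isZmodMorphism.Build _ _ _ (fBr x)).
by rewrite -[LHS]/(fl (x *~ r)) -[RHS]/(fr (m *~ r)) !raddfMz.
Qed.

Lemma bitensDl x x' m : bitens (x + x') m = bitens x m + bitens x' m.
Proof. exact: (balDl (tens_balanced _ _)). Qed.

Lemma bitensDr x m m' : bitens x (m + m') = bitens x m + bitens x m'.
Proof. exact: (balDr (tens_balanced _ _)). Qed.

Lemma bitensA x a m : bitens (bim_ract x a) m = bitens x (a *: m).
Proof. exact: (balA (tens_balanced _ _)). Qed.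

Lemma bitensBr x m m' : bitens x (m - m') = bitens x m - bitens x m'.
Proof. exact: (@tensBr int (zmodule P) (zmodule M)). Qed.

Lemma bitens_suml I (r : seq I) (F : I -> P) m :
  bitens (\sum_(i <- r) F i) m = \sum_(i <- r) bitens (F i) m.
Proof. exact: (@tens_suml int (zmodule P) (zmodule M)). Qed.

Lemma bitensor_eq (W : zmodType) (f g : bitensor M -> W) :
  {morph f : s t / s - t} -> {morph g : s t / s - t} ->
  (forall x m, f (bitens x m) = g (bitens x m)) ->
  forall t, f t = g t.
Proof. exact: tensor_eq. Qed.

(** Left multiplication by [a] descends to the tensor product over [S] because it commutes with the
    right action of [S]. *)
Lemma bitensor_scale_balanced a :
  @balanced int (zmodule P) (zmodule M) S (@bim_ract _ _ P) *:%R (bitensor M)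
    (fun x m => bitens (bim_lact a x) m).
Proof.
apply: biadditive_balanced => [x x' m|x m m'|x b m].
- by rewrite bim_lactDr bitensDl.
- exact: bitensDr.
- by rewrite bim_lractA bitensA.
Qed.

Definition bitensor_scale (a : T) (t : bitensor M) : bitensor M :=
  tensor_lift (bitensor_scale_balanced a) t.

Lemma bitensor_scaleB a : {morph bitensor_scale a : s t / s - t}.
Proof. exact: (tensor_liftB (bitensor_scale_balanced a)). Qed.

Lemma bitensor_scaleE a x m :
  bitensor_scale a (bitens x m) = bitens (bim_lact a x) m.
Proof. exact: (tensor_liftE (bitensor_scale_balanced a)). Qed.

Lemma bitensor_scaleA a b t :
  bitensor_scale a (bitensor_scale b t) = bitensor_scale (a * b) t.
Proof.
move: t; apply: bitensor_eq => [s t|s t|x m]; rewrite ?bitensor_scaleB //.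
by rewrite !bitensor_scaleE bim_lactA.
Qed.

Lemma bitensor_scale1 : left_id 1 bitensor_scale.
Proof.
apply: bitensor_eq => [s t|s t|x m]; rewrite ?bitensor_scaleB //.
by rewrite bitensor_scaleE bim_lact1.
Qed.

Lemma bitensor_scaleDr : right_distributive bitensor_scale +%R.
Proof.
move=> a s t; apply: (addIr (bitensor_scale a (- t))).
(* The lifted map is known to respect differences only; negation is recovered from 0 - u, with 0
   written as 0 - 0. *)
have scaleN u : bitensor_scale a (- u) = - bitensor_scale a u.
  rewrite -sub0r bitensor_scaleB -[0 in LHS](subrr 0) bitensor_scaleB.
  by rewrite subrr sub0r.
by rewrite scaleN addrK -bitensor_scaleB addrK.
Qed.

Lemma bitensor_scaleDl t : {morph bitensor_scale^~ t : a b / a + b}.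
Proof.
move=> a b; move: t.
apply: bitensor_eq => [s t|s t|x m]; rewrite ?bitensor_scaleB //.
  by rewrite opprD addrACA.
by rewrite !bitensor_scaleE bim_lactDl bitensDl.
Qed.

HB.instance Definition _ := GRing.Zmodule_isLmodule.Build T (bitensor M)
  bitensor_scaleA bitensor_scale1 bitensor_scaleDr bitensor_scaleDl.

Lemma bitens_scale a x m : a *: bitens x m = bitens (bim_lact a x) m.
Proof. exact: bitensor_scaleE. Qed.

Section AdditiveLift.
Variables (W : zmodType) (f : P -> M -> W).
Hypothesis fDl : forall x x' m, f (x + x') m = f x m + f x' m.
Hypothesis fDr : forall x m m', f x (m + m') = f x m + f x m'.
Hypothesis fA : forall x a m, f (bim_ract x a) m = f x (a *: m).

Definition bitensor_lift_fun (t : bitensor M) : W :=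
  tensor_lift (biadditive_balanced fDl fDr fA) t.

Lemma bitensor_lift_funE x m : bitensor_lift_fun (bitens x m) = f x m.
Proof. exact: (tensor_liftE (biadditive_balanced fDl fDr fA)). Qed.

Lemma bitensor_lift_funB : {morph bitensor_lift_fun : s t / s - t}.
Proof. exact: (tensor_liftB (biadditive_balanced fDl fDr fA)). Qed.

Lemma bitensor_lift_funD : {morph bitensor_lift_fun : s t / s + t}.
Proof.
move=> s t; apply: (addIr (- bitensor_lift_fun t)).
by rewrite -bitensor_lift_funB !addrK.
Qed.

End AdditiveLift.

Section LinearLift.
Variables (W : lmodType T) (f : P -> M -> W).
Hypothesis fDl : forall x x' m, f (x + x') m = f x m + f x' m.
Hypothesis fDr : forall x m m', f x (m + m') = f x m + f x m'.
Hypothesis fA : forall x a m, f (bim_ract x a) m = f x (a *: m).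
Hypothesis fZ : forall a x m, f (bim_lact a x) m = a *: f x m.

Lemma bitensor_lift_is_linear : linear (bitensor_lift_fun fDl fDr fA).
Proof.
move=> a s t; rewrite bitensor_lift_funD; congr (_ + _); move: s.
apply: bitensor_eq => [s s'|s s'|x m].
- by rewrite scalerBr bitensor_lift_funB.
- by rewrite bitensor_lift_funB scalerBr.
by rewrite bitens_scale !bitensor_lift_funE fZ.
Qed.

Definition bitensor_lift : {linear bitensor M -> W} :=
  HB.pack (bitensor_lift_fun fDl fDr fA)
    (GRing.isLinear.Build _ _ _ _ _ bitensor_lift_is_linear).

Lemma bitensor_liftE x m : bitensor_lift (bitens x m) = f x m.
Proof. exact: bitensor_lift_funE. Qed.

End LinearLift.

Lemma bitensor_linear_eq (W : lmodType T) (f g : {linear bitensor M -> W}) :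
  (forall x m, f (bitens x m) = g (bitens x m)) ->
  forall t, f t = g t.
Proof. by apply: bitensor_eq => s t; rewrite raddfB. Qed.

End Instances.

Section Map.
Variables (M N : lmodType S) (f : {linear M -> N}).

Definition bitensor_map : {linear bitensor M -> bitensor N}.
Proof.
apply: (@bitensor_lift M (bitensor N) (fun x m => bitens x (f m))) => *.
- exact: bitensDl.
- by rewrite raddfD bitensDr.
- by rewrite linearZ_LR bitensA.
- by rewrite bitens_scale.
Defined.

Lemma bitensor_mapE x m : bitensor_map (bitens x m) = bitens x (f m).
Proof. exact: bitensor_liftE. Qed.

End Map.

Lemma bitensor_map1 M : bitensor_map (lin_id M) = lin_id (bitensor M).
Proof. by apply/lin_eq/bitensor_linear_eq => x m; rewrite bitensor_mapE. Qed.

Lemma bitensor_mapM (M N L : lmodType S) (g : {linear N -> L})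
    (f : {linear M -> N}) :
  bitensor_map (lin_comp g f) = lin_comp (bitensor_map g) (bitensor_map f).
Proof.
apply/lin_eq/bitensor_linear_eq => x m.
by rewrite bitensor_mapE -[RHS]/(bitensor_map g (bitensor_map f _)) !bitensor_mapE.
Qed.

Definition bitensor_functor : functor (ModCat S) (ModCat T) :=
  @Functor (ModCat S) (ModCat T) (fun M : lmodType S => bitensor M : lmodType T)
    bitensor_map bitensor_map1 bitensor_mapM.

End BimoduleTensor.

(** * Morita pairings and the contraction isomorphism *)

Section Morita.
Variables (T S : pzRingType) (P : bimodule T S) (Q : bimodule S T).

(** One of the two pairings of a Morita context, [qp], is described here; [pq] enters through the
    mixed associativity laws. The other pairing is covered by the same record with all roles
    exchanged. Since the image of [qp] spans a two-sided ideal, [mp_span] amounts to surjectivity of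
    the induced map on the tensor product. *)
Record morita_pairing (qp : Q -> P -> S) (pq : P -> Q -> T) : Prop :=
  MoritaPairing {
    mp_Dl : forall y y' x, qp (y + y') x = qp y x + qp y' x;
    mp_Dr : forall y x x', qp y (x + x') = qp y x + qp y x';
    mp_Zl : forall a y x, qp (bim_lact a y) x = a * qp y x;
    mp_Zr : forall y x a, qp y (bim_ract x a) = qp y x * a;
    mp_bal : forall y b x, qp (bim_ract y b) x = qp y (bim_lact b x);
    mp_lact : forall x y x', bim_lact (pq x y) x' = bim_ract x (qp y x');
    mp_ract : forall y x y', bim_ract y (pq x y') = bim_lact (qp y x) y';
    mp_span : exists r : seq (Q * P), 1 = \sum_(z <- r) qp z.1 z.2
  }.

Variables (qp : Q -> P -> S) (pq : P -> Q -> T).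
Hypothesis mp : morita_pairing qp pq.

Section Counit.
Variable M : lmodType S.

Definition contract (y : Q) : bitensor P M -> M.
Proof.
apply: (@bitensor_lift_fun _ _ P M M (fun x m => qp y x *: m)) => *.
- by rewrite (mp_Dr mp) scalerDl.
- exact: scalerDr.
- by rewrite (mp_Zr mp) scalerA.
Defined.

Lemma contractE y x m : contract y (bitens x m) = qp y x *: m.
Proof. exact: bitensor_lift_funE. Qed.

Lemma contractB y : {morph contract y : s t / s - t}.
Proof. exact: bitensor_lift_funB. Qed.

Lemma contractD y : {morph contract y : s t / s + t}.
Proof. exact: bitensor_lift_funD. Qed.

(** The map is lifted in two stages: [contract] is the inner lift for a fixed [y], and the outer
    lift lets [y] vary. *)
Definition counit : {linear bitensor Q (bitensor P M) -> M}.
Proof.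
apply: (@bitensor_lift _ _ Q _ M contract) => [y y' t|y t t'|y b t|a y t].
- move: t; apply: bitensor_eq => [s t|s t|x m]; rewrite ?contractB //.
    by rewrite opprD addrACA.
  by rewrite !contractE (mp_Dl mp) scalerDl.
- exact: contractD.
- move: t; apply: bitensor_eq => [s t|s t|x m].
  + by rewrite contractB.
  + by rewrite scalerBr contractB.
  + by rewrite bitens_scale !contractE (mp_bal mp).
- move: t; apply: bitensor_eq => [s t|s t|x m].
  + by rewrite contractB.
  + by rewrite contractB scalerBr.
  + by rewrite !contractE (mp_Zl mp) scalerA.
Defined.

Lemma counitE y x m : counit (bitens y (bitens x m)) = qp y x *: m.
Proof. by rewrite /counit bitensor_liftE contractE. Qed.

Lemma counit_bij : bijective counit.
Proof.
have [r r1] := mp_span mp.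
(* The pairs in [r] decompose 1 and define the inverse; additivity of [g] is enough here. *)
pose g m : bitensor Q (bitensor P M) :=
  \sum_(z <- r) bitens z.1 (bitens z.2 m).
have gB : {morph g : m n / m - n}.
  by move=> m n; rewrite /g -sumrB; apply: eq_bigr => z _; rewrite !bitensBr.
exists g => [t|m]; last first.
  rewrite raddf_sum -[RHS]scale1r r1 scaler_suml.
  by apply: eq_bigr => z _; exact: counitE.
move: t; apply: bitensor_eq => [s t|//|y t]; first by rewrite raddfB gB.
(* With [y] fixed, a second reduction to pure tensors treats the inner factor. *)
pose g' (t : bitensor P M) := g (counit (bitens y t)).
move: t; apply: (@bitensor_eq _ _ P M _ g' (bitens y)) => [s t|s t|x m].
- by rewrite /g' /counit !bitensor_liftE contractB gB.
- exact: bitensBr.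
(* On the right, 1 acting on [y] is expanded along [r]. On the left, the scalar [qp y x] moves onto
   [z.2], where it equals [pq z.2 y] acting on [x]; this scalar of [T] then crosses the outer tensor
   to [z.1], giving [qp z.1 z.2] acting on [y]. *)
rewrite /g' counitE /g -[in RHS](bim_lact1 y) r1.
rewrite bim_lact_suml bitens_suml; apply: eq_bigr => z _.
by rewrite -bitensA -(mp_lact mp) -bitens_scale -bitensA (mp_ract mp).
Qed.

End Counit.

(** On pure tensors both sides are [qp y x *: f m], by linearity of [f]. *)
Lemma counit_natural (M N : lmodType S) (f : {linear M -> N}) :
  lin_comp (counit N) (bitensor_map Q (bitensor_map P f)) =
  lin_comp f (counit M).
Proof.
apply/lin_eq/bitensor_linear_eq => y t.
pose l t' := counit N (bitensor_map Q (bitensor_map P f) (bitens y t')).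
pose r t' := f (counit M (bitens y t')).
move: t; apply: (@bitensor_eq _ _ P M _ l r) => [s t|s t|x m].
- by rewrite /l bitensBr !raddfB.
- by rewrite /r bitensBr !raddfB.
- rewrite /l /r bitensor_mapE (bitensor_mapE f).
  by rewrite !counitE linearZ_LR.
Qed.

End Morita.

(** * From bijective contractions to an equivalence of categories *)

Lemma linear_bij_inv (S : pzRingType) (M N : lmodType S) (f : {linear M -> N}) :
  bijective f ->
  exists h : {linear N -> M}, lin_comp h f = lin_id M /\ lin_comp f h = lin_id N.
Proof.
case=> g fK gK.
pose h : {linear N -> M} :=
  HB.pack g (GRing.isLinear.Build _ _ _ _ _ (GRing.can2_linear fK gK)).
by exists h; split; apply: lin_eq.
Qed.

Lemma nat_iso_inhabited (C D : category) (F G : functor C D)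
    (e : forall x, hom (F x) (G x)) :
  (forall x, exists h, comp h (e x) = idm (F x) /\ comp (e x) h = idm (G x)) ->
  (forall x y (f : hom x y), comp (e y) (fmor F f) = comp (fmor G f) (e x)) ->
  inhabited (nat_iso F G).
Proof.
(* The inverses are only known to exist object by object, so they are selected by choice. *)
move=> einv enat; pose inv x := cid (einv x).
constructor; exists e (fun x => sval (inv x)) => //.
- by move=> x; case: (svalP (inv x)).
- by move=> x; case: (svalP (inv x)).
Qed.

(** The contraction for [qp] trivializes one composite of the two tensor functors, and that for [pq]
    trivializes the other. *)
Theorem morita_equivalent (S T : pzRingType) (P : bimodule T S) (Q : bimodule S T)
    (qp : Q -> P -> S) (pq : P -> Q -> T) :
  morita_pairing qp pq -> morita_pairing pq qp ->
  equivalent (ModCat S) (ModCat T).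
Proof.
move=> mqp mpq; pose F := bitensor_functor P; pose G := bitensor_functor Q.
exists F, G; split.
- apply: (@nat_iso_inhabited _ _ (functor_comp G F) (functor_id _) (counit mqp)).
    by move=> M; apply/linear_bij_inv/counit_bij.
  by move=> M N f; apply: counit_natural.
- apply: (@nat_iso_inhabited _ _ (functor_comp F G) (functor_id _) (counit mpq)).
    by move=> M; apply/linear_bij_inv/counit_bij.
  by move=> M N f; apply: counit_natural.
Qed.

(** * The Morita context of a Peirce algebra *)

Section PeirceMorita.
Variables (R : comPzRingType) (A : peirce_algebra R).

Lemma cmul_sumr i j l I (r : seq I) (x : component A i j) (F : I -> component A j l) :
  cmul x (\sum_(k <- r) F k) = \sum_(k <- r) cmul x (F k).
Proof.
elim: r => [|k r IH]; first by rewrite !big_nil cmulr0.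
by rewrite !big_cons cmulDr IH.
Qed.

Lemma cmul_suml i j l I (r : seq I) (F : I -> component A i j) (y : component A j l) :
  cmul (\sum_(k <- r) F k) y = \sum_(k <- r) cmul (F k) y.
Proof.
elim: r => [|k r IH]; first by rewrite !big_nil cmul0r.
by rewrite !big_cons cmulDl IH.
Qed.

Lemma cmul_map_span i k l (t : ctensor A i k l) :
  exists r : seq (component A i k * component A k l),
    cmul_map t = \sum_(z <- r) cmul z.1 z.2.
Proof.
have [r ->] := tensor_sum t; exists r.
elim: r => [|z r IH]; first by rewrite !big_nil cmul_map0.
rewrite !big_cons -IH -cmul_mapE.
apply: (addIr (- cmul_map (\sum_(z <- r) tens _ _ z.1 z.2))).
by rewrite -cmul_mapB !addrK.
Qed.

Variables (d : nat) (hA : strongly_unital A d) (hZ : unital (Z_rng A d)).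

Local Notation S := (unital_ring (strongly_unitalW hA)).
Local Notation T := (unital_ring hZ).
Local Notation P := (component A 0 d).
Local Notation Q := (component A d 0).

Definition Zval (t : T) : component A 0 0 := val (t : Zsub A d).

(** The 1 of [S] comes from a choice and is not the strong identity [u] by definition; writing [x]
    as x u and using u 1 = u closes the gap. *)
Lemma cmul_diag1 (x : P) : cmul x (1 : S) = x.
Proof.
have [u [xu _]] := hA.
by rewrite -[in LHS](xu x) -cmulA -[cmul u _]/((u : S) * 1) mulr1 xu.
Qed.

Lemma cmul_1diag (y : Q) : cmul (1 : S) y = y.
Proof.
have [u [_ uy]] := hA.
by rewrite -[in LHS](uy y) cmulA -[cmul _ u]/(1 * (u : S)) mul1r uy.
Qed.

(** This is the surjectivity in the Peirce isomorphism, put in the form of [mp_span]. *)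
Lemma diag_span (a : component A d d) :
  exists r : seq (Q * P), a = \sum_(z <- r) cmul z.1 z.2.
Proof.
by have [g _ gK] := peirce_iso A d; rewrite -(gK a); apply: cmul_map_span.
Qed.

Definition Zpair (x : P) (y : Q) : T := exist _ (cmul x y) (Zideal_cmul x y).

Lemma Zsub_span (t : T) : exists r : seq (P * Q), t = \sum_(z <- r) Zpair z.1 z.2.
Proof.
have /asboolP[g tg] := valP (t : Zsub A d).
have [r gr] := cmul_map_span g; exists r; apply: val_inj.
by rewrite -tg gr (raddf_sum val).
Qed.

Lemma cmul_1Z (x : P) : cmul (Zval 1) x = x.
Proof.
have [r r1] := diag_span (1 : S).
rewrite -[in RHS](cmul_diag1 x) -[in LHS](cmul_diag1 x) r1 !cmul_sumr.
apply: eq_bigr => z _; rewrite !cmulA; congr (cmul _ _); rewrite -cmulA.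
(* The product of [x] and [z.1] lies in the ideal, where its identity is neutral. *)
exact: (congr1 Zval (mul1r (Zpair x z.1))).
Qed.

Lemma cmul_Z1 (y : Q) : cmul y (Zval 1) = y.
Proof.
have [r r1] := diag_span (1 : S).
(* Expanding 1 to the left of [y] brings out products of [z.2] with [y], which lie in the ideal. *)
rewrite -[in RHS](cmul_1diag y) -[in LHS](cmul_1diag y) r1 !cmul_suml.
apply: eq_bigr => z _; rewrite -!cmulA; congr (cmul _ _); rewrite cmulA.
exact: (congr1 Zval (mulr1 (Zpair z.2 y))).
Qed.

Definition peirce_left : bimodule T S.
Proof.
apply: (@Bimodule T S P (fun t x => cmul (Zval t) x) (fun x a => cmul x a)) => *.
- exact: cmulDl.
- exact: cmulDr.
- exact: cmulA.
- exact: cmul_1Z.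
- exact: cmulDl.
- exact: cmulDr.
- by rewrite -cmulA.
- exact: cmul_diag1.
- exact: cmulA.
Defined.

Definition peirce_right : bimodule S T.
Proof.
apply: (@Bimodule S T Q (fun a y => cmul a y) (fun y t => cmul y (Zval t))) => *.
- exact: cmulDl.
- exact: cmulDr.
- exact: cmulA.
- exact: cmul_1diag.
- exact: cmulDl.
- exact: cmulDr.
- by rewrite -cmulA.
- exact: cmul_Z1.
- exact: cmulA.
Defined.

(** Every law is distributivity or associativity of the product; the spanning condition rests on the
    Peirce isomorphism. *)
Lemma diag_morita_pairing :
  @morita_pairing T S peirce_left peirce_right (fun y x => cmul y x) Zpair.
Proof.
split; rewrite /= => *.
- exact: cmulDl.
- exact: cmulDr.
- by rewrite -cmulA.
- exact: cmulA.
- by rewrite -cmulA.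
- by rewrite -cmulA.
- exact: cmulA.
- exact: diag_span.
Qed.

(** The identities with values in the ideal are checked in the degree (0,0) component, and spanning
    holds because the ideal is by definition the image of this pairing. *)
Lemma Z_morita_pairing :
  @morita_pairing S T peirce_right peirce_left Zpair (fun y x => cmul y x).
Proof.
split; rewrite /= => *.
- by apply: val_inj; apply: cmulDl.
- by apply: val_inj; apply: cmulDr.
- by apply: val_inj; rewrite /= -cmulA.
- by apply: val_inj; apply: cmulA.
- by apply: val_inj; rewrite /= -cmulA.
- by rewrite -cmulA.
- exact: cmulA.
- exact: Zsub_span.
Qed.

End PeirceMorita.

Theorem theorem3p2p1 (R : comPzRingType) (A : peirce_algebra R) (d : nat)
    (hA : strongly_unital A d) (hZ : unital (Z_rng A d)) :
  equivalent (ModCat (unital_ring (strongly_unitalW hA)))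
             (ModCat (unital_ring hZ)).
Proof.
exact: morita_equivalent (diag_morita_pairing hA hZ) (Z_morita_pairing hA hZ).
Qed.
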